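(* Let $v:[0,+\infty)\to\mathbb{R}$ be locally Lipschitz continuous, let $N\in\mathbb{N}$, $N\ge 1$, and let $X^0=(x_0^0,\ldots,x_N^0)\in\mathbb{R}^{N+1}$ with $x_0^0<x_1^0<\cdots<x_N^0$. Let $X(t)=(x_0(t),\ldots,x_N(t))$, $t\ge 0$, be the global solution of the Follow-the-Leader system with $X(0)=X^0$, and let $$\rho^N(t,x)=\sum_{i=1}^N R_i(t)\,\mathbf{1}_{[x_{i-1}(t),x_i(t))}(x).$$ Then, for all $t\ge 0$, $$TV[\rho^N(t,\cdot)]\le TV[\rho^N(0,\cdot)].$$
   Context: For a vector $X(t)=(x_0(t),\ldots,x_N(t))$ with $x_0(t)<\cdots<x_N(t)$ set $R_i(t)=\frac{1}{N(x_i(t)-x_{i-1}(t))}$, $i=1,\ldots,N$. The Follow-the-Leader system, posed on the open set of strictly increasing vectors of $\mathbb{R}^{N+1}$, is $$\dot x_0(t)=\min_{R\in[0,R_1(t)]}v(R),\qquad \dot x_N(t)=\max_{R\in[0,R_N(t)]}v(R),$$ and, for $i\in\{1,\ldots,N-1\}$, $$\dot x_i(t)=\begin{cases}\max_{R\in[R_{i+1}(t),R_i(t)]}v(R)&\text{if }R_i(t)\ge R_{i+1}(t),\\ \min_{R\in[R_i(t),R_{i+1}(t)]}v(R)&\text{if }R_i(t)<R_{i+1}(t).\end{cases}$$ For every strictly increasing initial vector the solution exists, is unique, is global in time and remains strictly increasing. $TV$ denotes total variation on $\mathbb{R}$; explicitly $$TV[\rho^N(t,\cdot)]=R_1(t)+\sum_{i=1}^{N-1}|R_{i+1}(t)-R_i(t)|+R_N(t).$$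 *)

(* Defs.v *)
From mathcomp Require Import all_boot all_order all_algebra.
From mathcomp Require Import all_classical all_reals all_analysis.

Set Implicit Arguments.
Unset Strict Implicit.
Unset Printing Implicit Defensive.

Import Order.TTheory GRing.Theory Num.Theory.
Import numFieldNormedType.Exports.

Local Open Scope classical_set_scope.
Local Open Scope ring_scope.

(* For v continuous on `[a, b], a <= b, the supremum and the infimum are
   attained, so these are the maximum and the minimum of v on `[a, b]. *)
Definition max_on (R : realType) (v : R -> R) (a b : R) : R :=
  sup (v @` `[a, b]).

Definition min_on (R : realType) (v : R -> R) (a b : R) : R :=
  inf (v @` `[a, b]).

Definition strictly_increasing (R : realType) (N : nat) (x : 'rV[R]_N.+1) :
    Prop :=
  forall i j : 'I_N.+1, (i < j)%N -> x 0 i < x 0 j.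

(* R_i, meaningful for 1 <= i <= N only (inord truncates outside 'I_N.+1). *)
Definition local_density (R : realType) (N : nat) (x : 'rV[R]_N.+1) (i : nat) :
    R :=
  (N%:R * (x 0 (inord i) - x 0 (inord i.-1)))^-1.

Definition ftl_velocity (R : realType) (v : R -> R) (N : nat)
    (x : 'rV[R]_N.+1) (i : 'I_N.+1) : R :=
  let r := local_density x in
  if (i == 0 :> nat)%N then min_on v 0 (r 1%N)
  else if (i == N :> nat)%N then max_on v 0 (r N)
  else if r i.+1 <= r i then max_on v (r i.+1) (r i)
  else min_on v (r i) (r i.+1).

(* Classical solution on [0, +oo[: the limits of the difference quotients are
   taken inside [0, +oo[, hence one-sided at t = 0; values of X at negative
   times are irrelevant. *)
Definition ftl_solution (R : realType) (v : R -> R) (N : nat)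
    (X0 : 'rV[R]_N.+1) (X : R -> 'rV[R]_N.+1) : Prop :=
  [/\ X 0 = X0,
      forall t : R, 0 <= t -> strictly_increasing (X t) &
      forall (t : R) (i : 'I_N.+1), 0 <= t ->
        (X s 0 i - X t 0 i) / (s - t) @[s --> within `[0, +oo[ t^']
          --> ftl_velocity v (X t) i].

Definition discrete_density (R : realType) (N : nat) (x : 'rV[R]_N.+1)
    (y : R) : R :=
  \sum_(1 <= i < N.+1)
    local_density x i * \1_(`[x 0 (inord i.-1), x 0 (inord i)[) y.

(* Total variation on the whole line. *)
Definition TV (R : realType) (f : R -> R) : \bar R :=
  ereal_sup [set total_variation p.1 p.2 f | p in [set p : R * R | p.1 <= p.2]].

(* Main.v *)
Require Import Defs.
From mathcomp Require Import all_boot all_order all_algebra.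
From mathcomp Require Import all_classical all_reals all_analysis.
From mathcomp Require Import ring lra.

Import Order.TTheory GRing.Theory Num.Theory.
Import numFieldNormedType.Exports.

Local Open Scope classical_set_scope.
Local Open Scope ring_scope.

(** Write r_1, ..., r_N for the densities and add two ghost densities
    r_0 = r_(N+1) = 0. With this convention the first and last vehicles obey the
    same law as the others, the velocity V_i of vehicle i depends only on r_i
    and r_(i+1), and [TV_discrete_density] says that the total variation of the
    density profile is

      g = sum_(0 <= i <= N) |r_(i+1) - r_i|.

    Fix a time s > 0 and freeze the signs sigma_i = sg(r_(i+1) - r_i) at time s.
    Since |u| >= sigma u whenever |sigma| <= 1, with equality when sigma is the
    sign of u, any earlier time t satisfies

      g(s) - g(t) <= sum_i sigma_i ((r_(i+1) - r_i)(s) - (r_(i+1) - r_i)(t)).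

    The right-hand side is linear in the increments of the densities. Comparing
    with earlier times is what makes the subgradient inequality point the useful
    way: it needs no separate treatment of the indices where r_i = r_(i+1),
    although g need not be differentiable there. By summation by parts, the
    derivative at time s of the frozen sum is

      sum_i (sigma_(i-1) - sigma_i) r_i',
      with r_i' = - N r_i^2 (V_i - V_(i-1)).

    Every term is nonpositive ([slope_sign_rate_le0]): sigma_(i-1) > sigma_i
    forces r_i to be a weak local maximum of the profile, so that V_i is a
    maximum of v over an interval containing r_i and V_(i-1) a minimum over
    such an interval, whence V_i >= v(r_i) >= V_(i-1); the case
    sigma_(i-1) < sigma_i is symmetric.

    Hence g is continuous and, at every s > 0, g(s) - g(t) <= e (s - t) for t
    close to s on the left, whatever e > 0 is. Such a function is bounded by
    its initial value ([le_of_left_slope]). *)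

(** * Total variation of step functions *)

Lemma sum_by_parts (R : comNzRingType) (a b : nat -> R) (n : nat) :
  \sum_(0 <= i < n.+1) a i * (b i.+1 - b i) =
  a n * b n.+1 - a 0%N * b 0%N + \sum_(0 <= i < n) (a i - a i.+1) * b i.+1.
Proof.
elim: n => [|n IHn]; first by rewrite big_nat1 big_geq//; ring.
by rewrite big_nat_recr//= IHn [in RHS]big_nat_recr//=; ring.
Qed.

Section step_functions.
Context {R : realType}.
Implicit Types (f g : R -> R) (a b c : R).

Local Notation jump a := (\1_(`[a, +oo[%classic) : R -> R).

Lemma jumpE a y : jump a y = (a <= y)%R%:R.
Proof.
rewrite indicE; congr (nat_of_bool _)%:R.
by apply/idP/idP; rewrite inE/= in_itv/= andbT.
Qed.

(** A multiple of a jump is monotone, and only the absolute value of the factor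
    matters since the total variation is invariant under negation. *)
Lemma total_variation_jump c p a b : a <= b ->
  (total_variation a b (fun y => c * jump p y)%R <= `|c|%R%:E)%E.
Proof.
move=> ab.
wlog c0 : c / 0 <= c => [hwlog|].
  have [/hwlog//|c0] := leP 0 c.
  rewrite -total_variationN -normrN.
  rewrite (_ : \- _ = fun y => - c * jump p y); last first.
    by apply/funext => y /=; rewrite mulNr.
  by apply: hwlog; rewrite oppr_ge0 ltW.
rewrite nondecreasing_total_variation//; last first.
  move=> x y _ _ xy; rewrite !jumpE ler_wpM2l// ler_nat.
  by case: (leP p x) => // px; rewrite (le_trans px xy).
rewrite lee_fin !jumpE (ger0_norm c0).
by case: (leP p a); case: (leP p b) => _ _; rewrite ?mulr1 ?mulr0; lra.
Qed.

Lemma total_variation_sum_jumps (n : nat) (c p : nat -> R) a b : a <= b ->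
  (total_variation a b (fun y => \sum_(0 <= i < n) c i * jump (p i) y)%R
     <= (\sum_(0 <= i < n) `|c i|)%R%:E)%E.
Proof.
move=> ab; elim: n => [|n IHn].
  under eq_fun do rewrite big_geq//.
  by rewrite big_geq// nondecreasing_total_variation// subrr.
under eq_fun do rewrite big_nat_recr//=.
rewrite big_nat_recr//= EFinD.
apply: le_trans (total_variation_le _ _ ab) _.
by apply: leeD => //; exact: total_variation_jump.
Qed.

Lemma sum_dist_le_total_variation (n : nat) (q : nat -> R) f :
  (forall i, (i < n)%N -> q i <= q i.+1) ->
  q 0%N <= q n /\ ((\sum_(0 <= i < n) `|f (q i.+1) - f (q i)|)%R%:E
     <= total_variation (q 0%N) (q n) f)%E.
Proof.
elim: n => [_|n IHn qle]; first by rewrite big_geq// total_variationxx.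
have [|q0n le_n] := IHn; first by move=> i ni; apply: qle; rewrite ltnS ltnW.
have qn := qle n (ltnSn n).
split; first exact: le_trans qn.
rewrite big_nat_recr//= EFinD (total_variationD f q0n qn).
by apply: leeD => //; exact: total_variation_ge.
Qed.

(** A step function vanishing at both ends is a combination of jumps whose
    coefficients are the increments of its values. Subadditivity of the total
    variation gives one inequality; the other one comes from sampling at the
    break points and at one point to the left of all of them. *)
Lemma TV_step_function (n : nat) (p r : nat -> R) :
    {in [pred i | (i <= n)%N] &, {mono p : i j / (i <= j)%N >-> i <= j}} ->
    r 0%N = 0 -> r n.+1 = 0 ->
  TV (fun y => \sum_(1 <= i < n.+1) r i * \1_(`[p i.-1, p i[%classic) y) =
    (\sum_(0 <= i < n.+1) `|r i.+1 - r i|)%:E.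
Proof.
move=> p_mono r0 rn.
rewrite (_ : (fun y => _) =
    fun y => \sum_(0 <= i < n.+1) (r i.+1 - r i) * jump (p i) y); last first.
  apply/funext => y; under [RHS]eq_bigr do rewrite mulrC.
  rewrite sum_by_parts r0 rn !mulr0 subrr add0r big_add1 /=.
  apply: eq_big_nat => i /andP[_ ni].
  rewrite mulrC !jumpE indicE; congr (_ * _).
  have pi : p i <= p i.+1 by rewrite p_mono// inE// ltnW.
  have -> : (y \in `[p i, p i.+1[%classic) = (p i <= y < p i.+1).
    by apply/idP/idP; rewrite inE/= in_itv.
  case: (leP (p i.+1) y) => [pSy|ypS].
    by rewrite (le_trans pi pSy) subrr.
  by rewrite subr0 andbT.
set f := fun y => _.
apply/eqP; rewrite eq_le; apply/andP; split.
  apply: ge_ereal_sup => _ [[a b] /= ab <-].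
  exact: total_variation_sum_jumps.
(* The shift by 1 is arbitrary: any point left of [p 0] has value 0. *)
pose q i := if i is j.+1 then p j else p 0%N - 1.
have fq i : (i <= n.+1)%N -> f (q i) = r i.
  case: i => [|j] /= jn; rewrite /f.
    rewrite big_nat_cond big1 ?r0// => i /andP[/andP[_ ni] _].
    rewrite jumpE leNgt (lt_le_trans (_ : p 0%N - 1 < p 0%N)) ?mulr0//.
      by lra.
    by rewrite p_mono// inE// ltnS.
  rewrite (big_cat_nat (n := j.+1))//= [X in _ + X]big_nat_cond.
  rewrite [X in _ + X]big1 ?addr0; last first.
    move=> i /andP[/andP[ji ni] _].
    by rewrite jumpE p_mono ?inE// leqNgt ji mulr0.
  transitivity (r j.+1 - r 0%N); last by rewrite r0 subr0.
  rewrite -telescope_sumr//; apply: eq_big_nat => i /andP[_ ij].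
  have le_ij : (i <= j)%N by [].
  have le_in : (i <= n)%N by exact: leq_trans le_ij jn.
  by rewrite jumpE p_mono ?inE// le_ij mulr1.
have [|q0n] := @sum_dist_le_total_variation n.+1 q f.
  case=> [_|i ni] /=; first by lra.
  by rewrite p_mono ?inE// ltnW.
rewrite (eq_big_nat _ _ (F2 := fun i => `|r i.+1 - r i|)); last first.
  by move=> i /andP[_ ni]; rewrite !fq// ltnW.
move=> /le_trans; apply.
by apply: ereal_sup_ubound; exists (q 0%N, q n.+1).
Qed.

End step_functions.

(** * Functions with nonpositive left slopes *)

Section monotonicity.
Context {R : realType}.
Implicit Types (g : R -> R) (s t T : R).

Lemma cvg_within_dnbhs_eq (A : set R) (f g : R -> R) t (l : R) :
    (forall s, s != t -> A s -> f s = g s) ->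
  f @ within A t^' --> l -> g @ within A t^' --> l.
Proof.
move=> fg fl P Pl.
have h : \forall s \near t, s != t -> A s -> P (f s) by exact: (fl _ Pl).
suff : \forall s \near t, s != t -> A s -> P (g s) by [].
by apply: filterS h => s h st As; rewrite -fg//; exact: h.
Qed.

Lemma cvg_within_dnbhs (T : topologicalType) (A : set R) (g : R -> T) t :
  g @ within A t^' --> g t -> g @ within A (nbhs t) --> g t.
Proof.
move=> gt P Pgt; have h : \forall y \near t, y != t -> A y -> P (g y).
  exact: (gt _ Pgt).
suff : \forall y \near t, A y -> P (g y) by [].
apply: filterS h => y h Ay.
by have [->|yt] := eqVneq y t; [exact: nbhs_singleton|exact: h].
Qed.

Lemma at_left_sub_within_dnbhs (s : R) : 0 < s ->
  s^'- `=>` within `[0, +oo[%classic s^'.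
Proof.
move=> s0 P h.
have {}h : \forall y \near s, y != s -> `[0, +oo[%classic y -> P y by exact: h.
suff : \forall y \near s, y < s -> P y by [].
near=> y => ys; have y0 : `[0, +oo[%classic y.
  by rewrite /= in_itv/= andbT ltW//; near: y; exact: lt_nbhsr.
have := lt_eqF ys => /negbT; move: y0; near: y.
by apply: filterS h => y h y0 ys; exact: h.
Unshelve. all: by end_near. Qed.

(** For k > 0, the function g(t) - k t has a maximum on [0, T]. It cannot be
    attained at a point c > 0, because to the left of c the slopes of
    g(t) - k t are at most k / 2 - k < 0, so that larger values occur there.
    Hence g(T) <= g(0) + k T, and k is arbitrary. *)
Lemma le_of_left_slope g T : 0 <= T ->
    (forall t, 0 <= t -> g @ within `[0, +oo[%classic (nbhs t) --> g t) ->
    (forall s e, 0 < s -> 0 < e ->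
      \forall t \near s^'-, g s - g t <= e * (s - t)) ->
  g T <= g 0.
Proof.
move=> T0 gC gslope; apply/ler_addgt0Pr => e e0.
(* Dividing by [T + 1] rather than [T] covers T = 0. *)
pose k := e / (T + 1).
have k0 : 0 < k by rewrite divr_gt0// ltr_wpDl.
pose h t := g t - k * t.
have [|c] := @EVT_max R h 0 T T0.
  apply/subspace_continuousP => x /=; rewrite in_itv/= => /andP[x0 xT].
  apply: cvgB; last first.
    apply: cvgMr; apply: cvg_within_filter; exact: cvg_id.
  apply: cvg_trans (gC x x0) => P.
  rewrite /within /= !nbhs_simpl /=. apply: filterS => y yP.
  by rewrite /= in_itv/= => /andP[y0 _]; apply: yP; rewrite /= in_itv/= y0.
rewrite in_itv/= => /andP[c0 cT] cmax.
have [c_eq0|c_gt0] := leP c 0.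
  have {c0 c_eq0}c0 : c = 0 by apply/eqP; rewrite eq_le c_eq0.
  have := cmax T; rewrite in_itv/= T0 lexx c0 /h => /(_ isT).
  have : k * T <= e.
    by rewrite /k mulrAC ler_pdivrMr ?ltr_wpDl// ler_wpM2l ?ltW// ltrDl.
  lra.
have near_t : \forall t \near c^'-,
    [/\ 0 <= t, t < c & g c - g t <= k / 2 * (c - t)].
  near=> t; split => //; near: t; first exact: nbhs_left_ge.
  by apply: gslope => //; rewrite divr_gt0.
have [t [t0 tc gct]] := filter_ex near_t.
have := cmax t; rewrite in_itv/= t0 (le_trans (ltW tc) cT) /h => /(_ isT).
have : 0 < k * (c - t) by rewrite mulr_gt0// subr_gt0.
lra.
Unshelve. all: by end_near. Qed.

End monotonicity.

(** * Extrema of the speed law *)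

Section extrema.
Context {R : realType}.
Implicit Types (v : R -> R) (a b c : R).

(** The local Lipschitz bound at r is a bound on a neighbourhood of the pair
    (r, r), which is then used on the slice of pairs (r, y). *)
Lemma locally_lipschitz_within_continuous v :
  [locally [lipschitz v r | r in `[0, +oo[ ]] ->
  {within `[0, +oo[, continuous v}.
Proof.
move=> v_lip; apply/subspace_continuousP => x x0.
have [M [Mreal vM]] := v_lip (x, x) (conj x0 x0).
pose k := `|M| + 1.
have k0 : 0 < k by rewrite ltr_wpDl.
have Mk : M < k by rewrite (le_lt_trans (ler_norm _))// ltrDl.
have /= [[A B] /= [Ax Bx] AB] := vM k Mk.
apply/cvgrPdist_lt => e e0; rewrite near_withinE.
have e_k : 0 < e / k by rewrite divr_gt0.
near=> y => y0.
have By : B y by near: y.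
have /= := AB (x, y) (conj (nbhs_singleton Ax) By) (conj x0 y0).
rewrite /self_sub /= => /le_lt_trans; apply.
rewrite mulrC -ltr_pdivlMr//; near: y.
Unshelve. all: by end_near. Qed.

Context (v : R -> R) (v_cont : {within `[0, +oo[, continuous v}).

Let v_cont_itv a b : 0 <= a -> {within `[a, b], continuous v}.
Proof.
move=> a0; apply: continuous_subspaceW v_cont => x /=.
by rewrite !in_itv/= andbT => /andP[ax _]; exact: le_trans ax.
Qed.

Lemma le_max_on a b c : 0 <= a -> a <= c -> c <= b -> v c <= max_on v a b.
Proof.
move=> a0 ac cb; have cab : c \in `[a, b] by rewrite in_itv/= ac cb.
have [m _ vm] := @EVT_max R v a b (le_trans ac cb) (@v_cont_itv a b a0).
apply: ub_le_sup; last by exists c.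
by exists (v m) => _ [y + <-]; exact: vm.
Qed.

Lemma min_on_le a b c : 0 <= a -> a <= c -> c <= b -> min_on v a b <= v c.
Proof.
move=> a0 ac cb; have cab : c \in `[a, b] by rewrite in_itv/= ac cb.
have [m _ vm] := @EVT_min R v a b (le_trans ac cb) (@v_cont_itv a b a0).
apply: ge_inf; last by exists c.
by exists (v m) => _ [y + <-]; exact: vm.
Qed.

Lemma max_on_point a : max_on v a a = v a.
Proof. by rewrite /max_on set_itv1 image_set1 sup1. Qed.

End extrema.

(** * Densities and velocities of a configuration *)

Section ghost_density.
Context {R : realType} {N : nat}.
Implicit Types (v : R -> R) (x : 'rV[R]_N.+1) (i : nat).

(** The empty road on both sides of the platoon counts as cells of density 0. *)
Definition ghost_density x i : R :=
  if (1 <= i <= N)%N then local_density x i else 0.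

(** Velocities indexed by natural numbers, like the densities. *)
Definition velocity_at (v : R -> R) x i : R := ftl_velocity v x (inord i).

Lemma ghost_density_gt0 x i : strictly_increasing x ->
  (1 <= i <= N)%N -> 0 < ghost_density x i.
Proof.
move=> x_incr /[dup] iN /andP[i1 i_N]; rewrite /ghost_density iN /local_density.
have N0 : (0 < N)%N := leq_trans i1 i_N.
rewrite invr_gt0 mulr_gt0 ?ltr0n// subr_gt0; apply: x_incr.
by rewrite !inordK ?prednK ?ltnS//; exact: leqW.
Qed.

Lemma ghost_density_ge0 x i : strictly_increasing x -> 0 <= ghost_density x i.
Proof.
move=> x_incr; have [iN|iN] := boolP (1 <= i <= N)%N.
  by rewrite ltW// ghost_density_gt0.
by rewrite /ghost_density (negPf iN).
Qed.

Lemma TV_discrete_density x : strictly_increasing x ->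
  TV (discrete_density x) =
  (\sum_(0 <= i < N.+1) `|ghost_density x i.+1 - ghost_density x i|)%:E.
Proof.
move=> x_incr.
rewrite -(@TV_step_function _ N (fun i => x 0 (inord i)) (ghost_density x)).
- congr TV; apply/funext => y; apply: eq_big_nat => i /andP[i1 iN].
  by rewrite /ghost_density i1 -ltnS iN.
- have x_lt i j : (i < j)%N -> (j <= N)%N -> x 0 (inord i) < x 0 (inord j).
    move=> ij jN; apply: x_incr.
    by rewrite !inordK// ltnW// ltnS (leq_trans ij).
  move=> i j; rewrite !inE => iN jN.
  have [ij|ji|->] := ltngtP i j; last by rewrite lexx.
    by rewrite ltW// x_lt.
  by rewrite leNgt x_lt.
- by rewrite /ghost_density.
- by rewrite /ghost_density ltnn andbF.
Qed.

(** The ghost densities make the head of the platoon follow the generic law: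
    its velocity, a maximum over [0, r_N], is a maximum between the densities
    ahead and behind. At the tail the last hypothesis fails, since the first
    density is positive. *)
Lemma velocity_ge_nonincreasing v x i : {within `[0, +oo[, continuous v} ->
    strictly_increasing x -> (i <= N)%N -> (0 < N)%N ->
    ghost_density x i.+1 <= ghost_density x i ->
  v (ghost_density x i) <= velocity_at v x i /\
  v (ghost_density x i.+1) <= velocity_at v x i.
Proof.
move=> v_cont x_incr iN N0 rle.
have r0 j : 0 <= ghost_density x j by exact: ghost_density_ge0.
suff -> : velocity_at v x i =
    max_on v (ghost_density x i.+1) (ghost_density x i).
  by split; apply: le_max_on.
rewrite /velocity_at /ftl_velocity inordK//.
have [i0|i0] := eqVneq i 0%N.
  have := @ghost_density_gt0 x 1 x_incr; rewrite N0 => /(_ isT).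
  by move: rle; rewrite i0 leNgt {2}/ghost_density /= => /negPf ->.
have i1 : (1 <= i)%N by rewrite lt0n.
have [eqiN|neqiN] := eqVneq i N.
  by rewrite /ghost_density i1 iN eqiN ltnn andbF.
have ltiN : (i < N)%N by rewrite ltn_neqAle neqiN.
by move: rle; rewrite /ghost_density i1 iN ltiN /= => ->.
Qed.

(** Here it is the tail, whose velocity is a minimum over [0, r_1], that follows
    the generic law thanks to the ghost densities, and the last hypothesis fails
    at the head. *)
Lemma velocity_le_nondecreasing v x i : {within `[0, +oo[, continuous v} ->
    strictly_increasing x -> (i <= N)%N -> (0 < N)%N ->
    ghost_density x i <= ghost_density x i.+1 ->
  velocity_at v x i <= v (ghost_density x i) /\
  velocity_at v x i <= v (ghost_density x i.+1).
Proof.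
move=> v_cont x_incr iN N0 rle.
have r0 j : 0 <= ghost_density x j by exact: ghost_density_ge0.
(* When the two densities are equal the velocity is by definition a maximum,
   but over a single point. *)
suff [->|[-> <-]] :
  velocity_at v x i = min_on v (ghost_density x i) (ghost_density x i.+1) \/
  velocity_at v x i = v (ghost_density x i) /\
    ghost_density x i = ghost_density x i.+1.
- by split; apply: min_on_le.
- by [].
rewrite /velocity_at /ftl_velocity inordK//.
have [i0|i0] := eqVneq i 0%N.
  by left; rewrite i0 /ghost_density N0.
have i1 : (1 <= i)%N by rewrite lt0n.
have [eqiN|neqiN] := eqVneq i N.
  have := @ghost_density_gt0 x i x_incr; rewrite i1 iN => /(_ isT).
  by move: rle; rewrite leNgt {1}/ghost_density eqiN ltnn andbF => /negPf ->.
have ltiN : (i < N)%N by rewrite ltn_neqAle neqiN.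
move: rle; rewrite /ghost_density i1 iN ltiN /= => rle.
have [rge|_] := leP (local_density x i.+1) (local_density x i); last by left.
have -> : local_density x i.+1 = local_density x i.
  by apply/eqP; rewrite eq_le rge.
by right; rewrite max_on_point.
Qed.

(** The time derivative of the density prescribed by the system, obtained by
    differentiating 1 / (N (x_i - x_(i-1))); it vanishes for ghost densities. *)
Definition density_rate v x i : R :=
  - (N%:R * ghost_density x i ^+ 2 *
     (velocity_at v x i - velocity_at v x i.-1)).

Definition slope_sign x i : R :=
  Num.sg (ghost_density x i.+1 - ghost_density x i).

(** Weak local maxima of the density profile decrease, weak local minima
    increase, and elsewhere the two slope signs agree. *)
Lemma slope_sign_rate_le0 v x i : {within `[0, +oo[, continuous v} ->
    strictly_increasing x -> (i < N)%N ->
  (slope_sign x i - slope_sign x i.+1) * density_rate v x i.+1 <= 0.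
Proof.
move=> v_cont x_incr iN; have N0 : (0 < N)%N by exact: leq_trans iN.
rewrite /density_rate /slope_sign mulrN oppr_le0 mulrCA mulr_ge0//.
  by rewrite mulr_ge0// sqr_ge0.
have ge j := @velocity_ge_nonincreasing v x j v_cont x_incr ^~ N0.
have le j := @velocity_le_nondecreasing v x j v_cont x_incr ^~ N0.
have [] := (ge i (ltnW iN), le i (ltnW iN)).
have [] := (ge i.+1 iN, le i.+1 iN).
rewrite /=.
set a := ghost_density x i; set b := ghost_density x i.+1.
set c := ghost_density x i.+2.
set V := velocity_at v x i; set W := velocity_at v x i.+1.
have sg_up p q : p < q -> Num.sg (q - p) = 1 :> R.
  by move=> pq; rewrite gtr0_sg// subr_gt0.
have sg_dn p q : q < p -> Num.sg (q - p) = -1 :> R.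
  by move=> pq; rewrite ltr0_sg// subr_lt0.
have sg_eq p : Num.sg (p - p) = 0 :> R by rewrite subrr sgr0.
by have [ab|ba|<-] := ltgtP a b; have [bc|cb|<-] := ltgtP _ c => //=;
  do ?[move=> /(_ isT)[? ?]|move=> _|move=> /(_ isT)[? ?]];
  rewrite ?sg_eq ?(sg_up _ _ ab) ?(sg_up _ _ bc) ?(sg_dn _ _ ba)
    ?(sg_dn _ _ cb); lra.
Qed.

End ghost_density.

(** * Evolution of the total variation *)

Section solution.
Context {R : realType} {N : nat} {v : R -> R} {X0 : 'rV[R]_N.+1}
  {X : R -> 'rV[R]_N.+1} (X_sol : ftl_solution v X0 X).
Implicit Types s t e : R.

Let X_incr t : 0 <= t -> strictly_increasing (X t).
Proof. by case: X_sol => _ + _; apply. Qed.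

Local Notation near_at t := (within `[0, +oo[%classic t^').

Lemma position_cvg t (i : 'I_N.+1) : 0 <= t ->
  X s 0 i @[s --> near_at t] --> X t 0 i.
Proof.
move=> t0; have [_ _ /(_ t i t0) slope] := X_sol.
have dt : s - t @[s --> near_at t] --> (0 : R).
  rewrite -(subrr t); apply: cvgB; last exact: cvg_cst.
  by do 2 apply: cvg_within_filter; exact: cvg_id.
have : X t 0 i + (X s 0 i - X t 0 i) / (s - t) * (s - t) @[s --> near_at t] -->
    X t 0 i + ftl_velocity v (X t) i * 0.
  by apply: cvgD; [exact: cvg_cst|exact: cvgM slope dt].
rewrite mulr0 addr0; apply: cvg_within_dnbhs_eq => s st _.
by rewrite divfK ?subr_eq0// addrC subrK.
Qed.

Lemma local_density_cvg t i : 0 <= t -> (1 <= i <= N)%N ->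
  local_density (X s) i @[s --> near_at t] --> local_density (X t) i.
Proof.
move=> t0 iN; apply: cvgV.
  have := ghost_density_gt0 (X t) i (X_incr t t0) iN.
  by rewrite /ghost_density iN invr_gt0 => /lt0r_neq0.
apply: cvgM; first exact: cvg_cst.
by apply: cvgB; exact: position_cvg.
Qed.

Lemma ghost_density_cvg t i : 0 <= t ->
  ghost_density (X s) i @[s --> near_at t] --> ghost_density (X t) i.
Proof.
rewrite /ghost_density => t0; case: ifPn => [iN|_]; last exact: cvg_cst.
exact: local_density_cvg.
Qed.

(** The difference quotient of 1 / u is that of u multiplied by
    - 1 / (u(s) u(t)), so only the continuity of the densities is needed on top
    of the difference quotients of the positions. *)
Lemma ghost_density_slope t i : 0 <= t ->
  (ghost_density (X s) i - ghost_density (X t) i) / (s - t) @[s --> near_at t]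
    --> density_rate v (X t) i.
Proof.
move=> t0; have [iN|iN] := boolP (1 <= i <= N)%N; last first.
  rewrite /density_rate /ghost_density (negPf iN).
  rewrite expr0n mulr0 mul0r oppr0 addr0.
  under eq_fun do rewrite mul0r.
  exact: cvg_cst.
have [_ _ Xslope] := X_sol.
pose q s j : R := (X s 0 (inord j) - X t 0 (inord j)) / (s - t).
apply: (@cvg_within_dnbhs_eq R _ (fun s =>
  - (N%:R * (ghost_density (X s) i * ghost_density (X t) i) *
     (q s i - q s i.-1)))); last first.
  apply: cvgN; apply: cvgM; last by apply: cvgB; exact: Xslope.
  apply: cvgM; first exact: cvg_cst.
  by apply: cvgM; [exact: ghost_density_cvg|exact: cvg_cst].
move=> s st; rewrite /q /= in_itv/= andbT => s0.
have := ghost_density_gt0 (X s) i (X_incr s s0) iN.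
have := ghost_density_gt0 (X t) i (X_incr t t0) iN.
rewrite /ghost_density iN /local_density !invr_gt0.
move: (X t 0 (inord i)) (X t 0 (inord i.-1)) => a b.
move: (X s 0 (inord i)) (X s 0 (inord i.-1)) => c d ab cd.
have st0 : s - t != 0 by rewrite subr_eq0.
have N0 : N%:R != 0 :> R.
  by case/andP: iN => i1 iN; rewrite pnatr_eq0 -lt0n (leq_trans i1 iN).
have ab0 : a - b != 0 by apply: contraTneq ab => ->; rewrite mulr0 ltxx.
have cd0 : c - d != 0 by apply: contraTneq cd => ->; rewrite mulr0 ltxx.
by field; do ?[apply/andP; split].
Qed.

Definition density_variation (t : R) : R :=
  \sum_(0 <= i < N.+1) `|ghost_density (X t) i.+1 - ghost_density (X t) i|.

Lemma density_variation_cvg t : 0 <= t ->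
  density_variation @ within `[0, +oo[%classic (nbhs t) --> density_variation t.
Proof.
move=> t0; apply: cvg_within_dnbhs.
apply: cvg_big => [|i _]; first exact: add_continuous.
by apply: cvg_norm; apply: cvgB; exact: ghost_density_cvg.
Qed.

(** The signs are frozen at the later time s, where they compute the absolute
    values exactly; at the earlier time t they only underestimate them. *)
Lemma density_variation_left_slope
    (v_cont : {within `[0, +oo[, continuous v}) s e : 0 < s -> 0 < e ->
  \forall t \near s^'-,
    density_variation s - density_variation t <= e * (s - t).
Proof.
move=> s0 e0; have s_ge0 := ltW s0.
(* [q t] is the slope between s and t of the variation with frozen signs. *)
pose q t := \sum_(0 <= i < N.+1) slope_sign (X s) i *
  ((ghost_density (X t) i.+1 - ghost_density (X s) i.+1) / (t - s)
   - (ghost_density (X t) i - ghost_density (X s) i) / (t - s)).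
pose d := density_rate v (X s).
have q_cvg : q t @[t --> near_at s] -->
    \sum_(0 <= i < N.+1) slope_sign (X s) i * (d i.+1 - d i).
  apply: cvg_big => [|i _]; first exact: add_continuous.
  apply: cvgM; first exact: cvg_cst.
  by apply: cvgB; exact: ghost_density_slope.
have d_le0 : \sum_(0 <= i < N.+1) slope_sign (X s) i * (d i.+1 - d i) <= 0.
  have d0 : d 0%N = 0.
    by rewrite /d /density_rate /ghost_density expr0n mulr0 mul0r oppr0.
  have dN : d N.+1 = 0.
    rewrite /d /density_rate /ghost_density ltnn andbF.
    by rewrite expr0n mulr0 mul0r oppr0.
  rewrite sum_by_parts d0 dN !mulr0 subrr add0r big_nat_cond sumr_le0// => i.
  by rewrite andbT => /andP[_ iN]; exact/slope_sign_rate_le0/iN/X_incr.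
have q_lt : \forall t \near s^'-, q t < e.
  apply: (at_left_sub_within_dnbhs _ s0).
  by apply: (cvgr_lt _ q_cvg); exact: le_lt_trans d_le0 e0.
near=> t.
have ts : t < s by near: t; exact: nbhs_left_lt.
have qe : q t < e by near: t.
apply: (@le_trans _ _ (q t * (s - t)));
  last by rewrite ler_wpM2r ?subr_ge0 ?ltW.
rewrite /density_variation -sumrB mulr_suml ler_sum_nat// => i _.
set a := ghost_density (X s) i.+1 - ghost_density (X s) i.
set b := ghost_density (X t) i.+1 - ghost_density (X t) i.
have -> : slope_sign (X s) i *
  ((ghost_density (X t) i.+1 - ghost_density (X s) i.+1) / (t - s)
   - (ghost_density (X t) i - ghost_density (X s) i) / (t - s))
    * (s - t) = Num.sg a * a - Num.sg a * b.
  have ts0 : t - s != 0 by rewrite subr_eq0 lt_eqF.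
  rewrite /slope_sign -/a.
  by move: (Num.sg a) => sg_a; rewrite /a /b; field.
rewrite -{1}normrEsg lerB//.
apply: le_trans (ler_norm _) _; rewrite normrM normr_sg.
by case: (a != 0); rewrite ?mul1r ?mul0r.
Unshelve. all: by end_near. Qed.

End solution.

Theorem theorem3p1 (R : realType) (v : R -> R)
  (v_lip : [locally [lipschitz v r | r in `[0, +oo[ ]])
  (N : nat) (N_ge1 : (1 <= N)%N)
  (X0 : 'rV[R]_N.+1) (X0_incr : strictly_increasing X0)
  (X : R -> 'rV[R]_N.+1) (X_sol : ftl_solution v X0 X) :
  forall t : R, 0 <= t ->
    (TV (discrete_density (X t)) <= TV (discrete_density (X 0%R)))%E.
Proof.
move=> T T0; have v_cont := locally_lipschitz_within_continuous v v_lip.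
have [_ X_incr _] := X_sol.
rewrite !TV_discrete_density; [|exact: X_incr..].
rewrite lee_fin; apply: (le_of_left_slope (@density_variation R N X) T T0).
- by move=> t; exact: (density_variation_cvg X_sol).
- by move=> s e; exact: (density_variation_left_slope X_sol).
Qed.
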